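(* Let $k$ be an algebraically closed field of characteristic zero, let $G=\mathrm{Paut}(f)$ be the projective automorphism group of a nonsingular quartic form $f\in k[x,y,z,t]$, and let $|G|=\prod_p p^{\nu(p)}$ be the decomposition of $|G|$ into prime factors. Then $\nu(7)\leq 1$.
   Context: A quartic form is a homogeneous polynomial of degree $4$; it is nonsingular if it is nonzero and the projective algebraic set $V_p(f)\subset\mathbf{P}^3(k)$ is nonsingular. For $A\in GL_4(k)$, $f_{A^{-1}}$ denotes the form $v\mapsto f(Av)$, $(A)$ is the class of $A$ in $PGL_4(k)$, and $\mathrm{Paut}(f)=\{(A)\in PGL_4(k): f_{A^{-1}}=cf \text{ for some } c\in k^*\}$; it is a finite group when $f$ is nonsingular of degree $\geq 3$. *)

(* Defs.v *)
From HB Require Import structures.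
From mathcomp Require Import all_boot all_order all_algebra.
From mathcomp Require Import mpoly.
From mathcomp Require Import classical_sets cardinality.

Set Implicit Arguments.
Unset Strict Implicit.
Unset Printing Implicit Defensive.

Import GRing.Theory.
Local Open Scope quotient_scope.
Local Open Scope classical_set_scope.
Local Open Scope ring_scope.

Section ProjectiveLinearGroup.
Variable k : fieldType.

Definition GL4 := {A : 'M[k]_4 | A \in unitmx}.

Definition proportional (A B : GL4) : bool :=
  is_scalar_mx (invmx (val A) *m val B).

Lemma proportionalP (A B : GL4) :
  reflect (exists2 c : k, c != 0 & val B = c *: val A) (proportional A B).
Proof.
apply: (iffP is_scalar_mxP) => [[c eqc]|[c c0 ->]]; last first.
  by exists c; rewrite -scalemxAr mulVmx ?scalemx1 ?(valP A).
have eqB : val B = c *: val A.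
  by rewrite -[LHS](mulKVmx (valP A)) eqc mul_mx_scalar.
exists c => //; apply: contraTneq (valP B) => c0.
by rewrite eqB c0 scale0r unitmxE det0 unitr0.
Qed.

Lemma proportional_refl : reflexive proportional.
Proof. by move=> A; apply/proportionalP; exists 1; rewrite ?oner_neq0 ?scale1r. Qed.

Lemma proportional_sym : ssrbool.symmetric proportional.
Proof.
have sym A B : proportional A B -> proportional B A.
  move=> /proportionalP[c c0 eqB]; apply/proportionalP; exists c^-1.
    by rewrite invr_eq0.
  by rewrite eqB scalerA mulVf // scale1r.
by move=> A B; apply/idP/idP; apply: sym.
Qed.

Lemma proportional_trans : transitive proportional.
Proof.
move=> B A C /proportionalP[c c0 eqB] /proportionalP[d d0 eqC].
by apply/proportionalP; exists (d * c); rewrite ?mulf_neq0 // eqC eqB scalerA.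
Qed.

Canonical proportional_equiv :=
  EquivRel proportional proportional_refl proportional_sym proportional_trans.

Definition PGL4 := {eq_quot proportional}.

HB.instance Definition _ := Choice.on PGL4.

Definition PGL4_class (A : GL4) : PGL4 := \pi_{eq_quot proportional} A.

Lemma PGL4_classP (A B : GL4) :
  PGL4_class A = PGL4_class B <->
  exists2 c : k, c != 0 & val B = c *: val A.
Proof.
split=> [/eqP|/proportionalP eqAB]; last by apply/eqP; rewrite /PGL4_class eqmodE.
by rewrite /PGL4_class eqmodE => /proportionalP.
Qed.

End ProjectiveLinearGroup.

Section Forms.
Variable k : fieldType.
Implicit Types (f : {mpoly k[4]}) (A : 'M[k]_4) (v : 'cV[k]_4).

Definition eval_form f v : k := f.@[fun i => v i 0].

(* A point of P^3(k) is represented by any of its vectors of homogeneous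
   coordinates, and a point of V_p(f) is nonsingular when the gradient of f
   does not vanish there.  The condition concerns f, not only its zero locus:
   the square of a quadratic form is never nonsingular. *)
Definition nonsingular f : Prop :=
  f != 0 /\
  forall v, v != 0 -> eval_form f v = 0 ->
    exists i : 'I_4, eval_form f^`M(i) v != 0.

(* The polynomial of v |-> f(A v), written f_{A^-1} when A is invertible. *)
Definition form_act f A : {mpoly k[4]} :=
  f \mPo [tuple \sum_(j < 4) A i j *: 'X_j | i < 4].

Lemma eval_form_act f A v :
  eval_form (form_act f A) v = eval_form f (A *m v).
Proof.
rewrite /eval_form comp_mpoly_meval; apply: meval_eq => i.
rewrite tnth_mktuple mxE raddf_sum; apply: eq_bigr => j _.
by rewrite /= mevalZ mevalXU.
Qed.

Definition Paut f : set (PGL4 k) :=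
  [set PGL4_class A | A in
     [set A : GL4 k | exists2 c : k, c != 0 & form_act f (val A) = c *: f]].

End Forms.

(* Main.v *)
Require Import Defs.
From mathcomp Require Import all_boot all_order all_algebra.
From mathcomp Require Import all_fingroup all_solvable all_field ring.
From mathcomp Require Import mpoly.
From mathcomp Require Import boolp classical_sets cardinality.

Import GRing.Theory.

(* A subgroup of order 49 of PGL_4 is abelian, and lifts of its elements to GL_4
   commute even as matrices: the scalar by which they commute is killed by 4
   (determinants) and by 49.  Hence they share an eigenbasis e_0, ..., e_3.
   Nonsingularity of f at e_i provides an index s(i) such that x_i^3 x_s(i)
   occurs in f in these coordinates, so that suitably scaled lifts have 49th
   roots of unity a_i with a_i^3 a_s(i) = 1 as eigenvalues.  As
   a_s(i) = a_i^(-3), only a 3-cycle of s allows nontrivial a of 7-power order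
   (on it (-3)^3 - 1 = -28 annihilates a), and four indices leave room for one
   3-cycle; hence a is determined by one entry, which is a 7th root of unity:
   there are at most 7 classes. *)

Local Open Scope classical_set_scope.
Local Open Scope card_scope.
Local Open Scope ring_scope.

(** * Roots of unity and the combinatorics of weights on four indices *)

Lemma expr_coprime_eq1 (F : fieldType) (x : F) (m n : nat) :
  (0 < m)%N -> coprime m n -> x ^+ m = 1 -> x ^+ n = 1 -> x = 1.
Proof.
move=> m0 /eqP co xm xn; have [u v e _] := egcdnP n m0.
have : x ^+ (u * m) = x ^+ (v * n + gcdn m n) by rewrite e.
by rewrite co exprD mulnC exprM xm mulnC exprM xn !expr1n mul1r.
Qed.

Section CubicWeights.
Variables (F : fieldType) (s : 'I_4 -> 'I_4).
Implicit Types (a b : 'I_4 -> F) (i : 'I_4).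

Let not_uniq5 i0 i1 i2 i3 i4 : uniq [:: i0; i1; i2; i3; i4] = false.
Proof.
apply: contraFF (ltnn 4) => /card_uniqP/= <-.
by rewrite -[X in (_ <= X)%N](card_ord 4) max_card.
Qed.

Lemma weight_next b i :
  (forall i, b i ^+ 7 = 1) -> (forall i, b i ^+ 3 * b (s i) = 1) ->
  b (s i) = b i ^+ 4.
Proof.
move=> b7 bs; have b0 : b i ^+ 3 != 0.
  by apply: contra_eq_neq (bs i) => ->; rewrite mul0r eq_sym oner_neq0.
by apply: (mulfI b0); rewrite bs -exprD b7.
Qed.

(** Each step of [s] raises the value to the power 4, and 4 has order 3 modulo 7. A 7th root of
    unity other than 1 is primitive, so its powers 1, 4, 2 are distinct. *)
Lemma weight_orbit b i :
  (forall i, b i ^+ 7 = 1) -> (forall i, b i ^+ 3 * b (s i) = 1) ->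
  b i != 1 -> [/\ b (s (s i)) = b i ^+ 2, b (s (s (s i))) = b i
    & uniq [:: b i; b i ^+ 4; b i ^+ 2]].
Proof.
move=> b7 bs bi; have bn := fun i => weight_next b i b7 bs.
have b0 : b i != 0.
  by apply: contra_eq_neq (b7 i) => ->; rewrite expr0n eq_sym oner_neq0.
have bX m : (0 < m)%N -> coprime m 7 -> b i ^+ m != 1.
  by move=> m0 co; apply: contraNneq bi => bm; apply/eqP/(expr_coprime_eq1 _ _ m 7).
have ne m n : (0 < n)%N -> coprime n 7 -> b i ^+ m != b i ^+ (m + n).
  move=> n0 co; rewrite exprD -[X in X != _]mulr1 (inj_eq (mulfI _)) ?expf_neq0 //.
  by rewrite eq_sym bX.
split; first by rewrite !bn -exprM -[(4 * 4)%N]/(2 + 7 * 2)%N exprD exprM b7 expr1n mulr1.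
  by rewrite !bn -!exprM -[(4 * (4 * 4))%N]/(1 + 7 * 9)%N exprD exprM b7 expr1n mulr1.
rewrite /= !inE andbT negb_or.
by rewrite (ne 1 3)%N // (ne 1 1)%N // eq_sym (ne 2 2)%N.
Qed.

(* Where [a ^+ 7] is nontrivial it takes the values x, x^4, x^2, x, x^4 along the
   orbit of [s], which therefore reaches a 3-cycle; there [a] is killed by 28. *)
Lemma weight_seventh_root a i :
  (forall i, a i ^+ 49 = 1) -> (forall i, a i ^+ 3 * a (s i) = 1) ->
  a i ^+ 7 = 1.
Proof.
move=> a49 as1; apply/eqP/negPn/negP => ai.
pose b j := a j ^+ 7.
have b7 j : b j ^+ 7 = 1 by rewrite -exprM a49.
have bs j : b j ^+ 3 * b (s j) = 1 by rewrite exprAC -exprMn as1 expr1n.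
have [b2 b3] := weight_orbit b i b7 bs ai.
have b1 := weight_next b i b7 bs; have b4 := weight_next b (s (s (s i))) b7 bs.
have ne j l : b j != b l -> j == l = false by apply: contraNF => /eqP->.
rewrite /= !inE andbT negb_or => /andP[/andP[n1 n2] n3].
(* Among five indices two coincide. Comparing values of [b] leaves only [i = s (s (s i))] or
   [s i = s (s (s (s i)))], and the first implies the second. *)
have cyc : s (s (s (s i))) = s i.
  have m1 : b i ^+ 4 != b i by rewrite eq_sym.
  have m2 : b i ^+ 2 != b i by rewrite eq_sym.
  have m3 : b i ^+ 2 != b i ^+ 4 by rewrite eq_sym.
  have := not_uniq5 i (s i) (s (s i)) (s (s (s i))) (s (s (s (s i)))).
  rewrite /= !inE.
  rewrite (ne i (s i)) ?b1 // (ne i (s (s i))) ?b2 // (ne (s i) (s (s i))) ?b1 ?b2 //.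
  rewrite (ne i (s (s (s (s i))))) ?b4 ?b3 // (ne (s i) (s (s (s i)))) ?b1 ?b3 //.
  rewrite (ne (s (s i)) (s (s (s i)))) ?b2 ?b3 //.
  rewrite (ne (s (s i)) (s (s (s (s i))))) ?b2 ?b4 ?b3 //.
  rewrite (ne (s (s (s i))) (s (s (s (s i))))) ?b4 ?b3 //.
  rewrite /= !orbF !andbT.
  have [<-|_] //= := eqVneq i (s (s (s i))).
  by have [<-|] //= := eqVneq (s i) (s (s (s (s i)))).
have a0 j : a j ^+ 3 != 0.
  by apply: contra_eq_neq (as1 j) => ->; rewrite mul0r eq_sym oner_neq0.
have inv j : a (s j) = (a j ^+ 3)^-1.
  by apply: (mulfI (a0 j)); rewrite as1 mulfV.
(* Two steps from [s i] give [a (s (s (s i))) = a (s i) ^+ 9]; the relation there closes the cycle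
   with exponent 9 * 3 + 1. *)
have y28 : a (s i) ^+ 28 = 1.
  have := as1 (s (s (s i))); rewrite cyc (inv (s (s i))) (inv (s i)).
  by rewrite !exprVn invrK -!exprM -exprSr.
(* Since 49 = 28 + 7 * 3, the cube of [b (s i)] is 1, and so is its 7th power. *)
have b11 : b (s i) = 1.
  have := a49 (s i).
  rewrite -[49%N]/(28 + 7 * 3)%N exprD exprM y28 mul1r => b3s.
  exact: (expr_coprime_eq1 _ _ 3 7).
move: ai; rewrite -/(b i) (expr_coprime_eq1 _ (b i) 4 7) ?eqxx //.
by rewrite -b1.
Qed.

(** Quotients of weights are weights, so it suffices that a weight trivial at [p] is trivial. Take
    [p] moved by [s], if possible. A weight trivial at [p] is trivial at [s p]; nontrivial at [i],
    it would be nontrivial at the three distinct indices [i], [s i], [s (s i)], making five indices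
    in all. *)
Lemma weight_determined :
  exists p : 'I_4, forall a b,
    (forall i, a i ^+ 7 = 1) -> (forall i, a i ^+ 3 * a (s i) = 1) ->
    (forall i, b i ^+ 7 = 1) -> (forall i, b i ^+ 3 * b (s i) = 1) ->
    a p = b p -> a =1 b.
Proof.
suff [p ker] : exists p : 'I_4, forall b,
    (forall i, b i ^+ 7 = 1) -> (forall i, b i ^+ 3 * b (s i) = 1) ->
    b p = 1 -> forall i, b i = 1.
  exists p => a b a7 as1 b7 bs1 abp i.
  have b0 j : b j != 0.
    by apply: contra_eq_neq (b7 j) => ->; rewrite expr0n eq_sym oner_neq0.
  apply/(divIf (b0 i)); rewrite divff //.
  apply: (ker (fun j => a j / b j)) => [j|j|]; last by rewrite abp divff.
    by rewrite expr_div_n a7 b7 divr1.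
  by rewrite expr_div_n mulf_div as1 bs1 divr1.
have [/existsP[p sp]|/existsPn fixs] := boolP [exists p, s p != p].
  exists p => b b7 bs bp i; apply/eqP/negPn/negP => bi.
  have bsp : b (s p) = 1 by rewrite (weight_next b p) // bp expr1n.
  have bsi := weight_next b i b7 bs.
  have [bssi _] := weight_orbit b i b7 bs bi.
  have ne j l : b j != b l -> j == l = false by apply: contraNF => /eqP->.
  rewrite /= !inE andbT negb_or => /andP[/andP[n1 n2] n3].
  have bX m : (0 < m)%N -> coprime m 7 -> b i ^+ m != 1.
    by move=> m0 co; apply: contraNneq bi => bm; apply/eqP/(expr_coprime_eq1 _ _ m 7).
  have := not_uniq5 p (s p) i (s i) (s (s i)).
  rewrite /= !inE eq_sym (negPf sp) !(ne i) ?bsi ?bssi //.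
  rewrite (ne (s i) (s (s i))) ?bsi ?bssi //.
  by rewrite !(ne p) ?(ne (s p)) ?bp ?bsp ?bsi ?bssi // eq_sym ?bX.
(* If [s] fixes every index, then [b i ^+ 4 = 1] and all weights are trivial. *)
exists ord0 => b b7 bs _ i; apply: (expr_coprime_eq1 _ _ 4 7) => //.
by have := bs i; rewrite (eqP (negPn (fixs i))) -exprSr.
Qed.

End CubicWeights.

(** * Restriction of a form to lines, and eigenvectors *)

Lemma col_unit_neq0 (k : fieldType) (n : nat) (Q : 'M[k]_n) (i : 'I_n) :
  Q \in unitmx -> col i Q != 0.
Proof.
move=> Qu; apply/eqP; rewrite colE => /(congr1 (mulmx (invmx Q))).
rewrite mulKmx // mulmx0 => /matrixP/(_ i 0)/eqP.
by rewrite !mxE !eqxx oner_eq0.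
Qed.

Section Lines.
Variable k : fieldType.
Implicit Types (f : {mpoly k[4]}) (v w : 'cV[k]_4) (A : 'M[k]_4).

Definition line_poly f v w : {poly k} :=
  mmap (@polyC k) (fun i => (v i 0)%:P + w i 0 *: 'X) f.

Lemma horner_line_poly f v w t :
  (line_poly f v w).[t] = eval_form f (v + t *: w).
Proof.
rewrite /line_poly /eval_form mevalE /mmap horner_sum; apply: eq_bigr => m _.
rewrite hornerM hornerC; congr (_ * _).
rewrite /mmap1 horner_prod; apply: eq_bigr => i _.
by rewrite horner_exp !hornerE !mxE mulrC.
Qed.

Lemma line_poly0 f v w : (line_poly f v w)`_0 = eval_form f v.
Proof. by rewrite -horner_coef0 horner_line_poly scale0r addr0. Qed.

(** This is the derivative at 0 along [w]. Both sides are linear in [f] and obey the same product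
    rule, so constants and variables suffice. *)
Lemma line_poly1 f v w :
  (line_poly f v w)`_1 = \sum_(i < 4) w i 0 * eval_form f^`M(i) v.
Proof.
pose T f := (line_poly f v w)`_1 = \sum_(i < 4) w i 0 * eval_form f^`M(i) v.
have TD p q : T p -> T q -> T (p + q).
  rewrite /T /line_poly /= rmorphD coefD => -> ->; rewrite -big_split.
  by apply: eq_bigr => i _; rewrite /= mderivD /eval_form mevalD mulrDr.
have TZ c p : T p -> T (c *: p).
  rewrite /T /line_poly mmapZ coefCM => ->; rewrite mulr_sumr.
  by apply: eq_bigr => i _; rewrite mderivZ /eval_form mevalZ mulrCA.
have TM p q : T p -> T q -> T (p * q).
  rewrite /T => Tp Tq; rewrite /line_poly /= rmorphM /=.
  rewrite -/(line_poly p v w) -/(line_poly q v w).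
  rewrite coefM big_ord_recl big_ord1 /= !line_poly0 Tp Tq.
  rewrite mulr_sumr mulr_suml -big_split; apply: eq_bigr => i _ /=.
  by rewrite mderivM /eval_form mevalD !mevalM; ring.
have T1 : T 1.
  rewrite /T /line_poly rmorph1 coef1 big1 // => i _.
  by rewrite mderivC /eval_form meval0 mulr0.
have TX i : T 'X_i.
  rewrite /T /line_poly mmapX mmap1U coefD coefC coefZ coefX add0r mulr1.
  rewrite (bigD1 i) //= big1 ?addr0 => [|j ji].
    rewrite mderivX mnm1E eqxx (_ : _ - _ = 0)%MM; last first.
      by apply/mnmP => j; rewrite mnmBE mnm0E subnn.
    by rewrite mpolyX0 scale1r /eval_form meval1 mulr1.
  by rewrite mderivX mnm1E eq_sym (negPf ji) scale0r /eval_form meval0 mulr0.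
rewrite -/(T f); elim/mpolyind: f => [|c m p _ _ Tp].
  rewrite /T /line_poly rmorph0 coef0 big1 // => i _.
  by rewrite mderiv0 /eval_form meval0 mulr0.
apply: TD => //; apply: TZ; rewrite mpolyXE_id.
apply: big_rec => // i q _ Tq; apply: (TM) => //.
by elim: (m i) => [|n IH]; rewrite ?expr0 // exprS; apply: (TM).
Qed.

Lemma eval_form_scale f d (a : k) v :
  f \is d.-homog -> eval_form f (a *: v) = a ^+ d * eval_form f v.
Proof.
move=> hf; rewrite /eval_form !mevalE mulr_sumr big_seq [RHS]big_seq.
apply: eq_bigr => m mf; rewrite mulrCA; congr (_ * _).
rewrite -(dhomog_mf hf mf) /= mdegE -prodrXr -big_split; apply: eq_bigr => i _.
by rewrite mxE exprMn.
Qed.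

Lemma poly_horner_inj (p q : {poly k}) : [pchar k] =i pred0 ->
  (forall t, p.[t] = q.[t]) -> p = q.
Proof.
move=> char0 pq; apply/eqP; rewrite -subr_eq0; apply/eqP.
(* In characteristic zero the integers below the size of [p - q] are distinct, which is more roots
   than the degree allows. *)
apply: (@roots_geq_poly_eq0 _ _ [seq n%:R | n <- iota 0 (size (p - q))]).
- by apply/allP => t _; rewrite /root hornerD hornerN pq subrr.
- rewrite map_inj_uniq ?iota_uniq // => m n.
  wlog le_mn : m n / (m <= n)%N => [IH|] e.
    by case/orP: (leq_total m n) => le; [|symmetry]; apply: IH.
  apply/eqP; rewrite eqn_leq le_mn -subn_eq0 -((GRing.pcharf0P k).1 char0).
  by rewrite /= natrB // e subrr.
- by rewrite size_map size_iota.
Qed.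

(* Compare [f (A (v + t w)) = c f (v + t w)] with
   [f (a v + t b w) = a ^ 4 f (v + t (b / a) w)], coefficientwise in [t]. *)
Lemma line_poly_eigen f A v w (a b c : k) i : [pchar k] =i pred0 ->
  f \is 4.-homog -> form_act f A = c *: f ->
  A *m v = a *: v -> A *m w = b *: w -> a != 0 ->
  (line_poly f v w)`_i != 0 -> c = a ^+ 4 * (b / a) ^+ i.
Proof.
move=> char0 hf fA Av Aw a0 p1.
have E : c *: line_poly f v w =
    a ^+ 4 *: \poly_(j < size (line_poly f v w))
                ((line_poly f v w)`_j * (b / a) ^+ j).
  apply: poly_horner_inj => // t; rewrite !hornerZ horner_poly.
  rewrite [X in _ = _ * X](_ : _ = (line_poly f v w).[b / a * t]); last first.
    by rewrite horner_coef; apply: eq_bigr => j _; rewrite [(b / a * t) ^+ j]exprMn mulrA.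
  rewrite !horner_line_poly -eval_form_scale // scalerDr -Av scalerA !mulrA.
  rewrite [a * b]mulrC mulfK // [b * t]mulrC -scalerA -Aw scalemxAr -mulmxDr.
  by rewrite -eval_form_act fA /eval_form mevalZ.
have := congr1 (fun p : {poly k} => p`_i) E.
rewrite !coefZ coef_poly; case: ltnP => [_|/(nth_default 0) p0].
  by rewrite mulrCA mulrC => /(mulfI p1).
by rewrite p0 eqxx in p1.
Qed.

(* The gradient at [col i Q] pairs nontrivially with some column of [Q],
   unless [f] itself does not vanish there. *)
Lemma nonsingular_eigen_monomial f (Q : 'M[k]_4) : [pchar k] =i pred0 ->
  f \is 4.-homog -> nonsingular f -> Q \in unitmx ->
  exists s : 'I_4 -> 'I_4, forall A (a : 'I_4 -> k) (c : k),
    form_act f A = c *: f ->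
    (forall i, A *m col i Q = a i *: col i Q) -> (forall i, a i != 0) ->
    forall i, a i ^+ 3 * a (s i) = c.
Proof.
move=> char0 hf [_ ns] Qu.
suff ex i : exists j : 'I_4, forall A (a : 'I_4 -> k) (c : k),
    form_act f A = c *: f ->
    (forall i, A *m col i Q = a i *: col i Q) -> (forall i, a i != 0) ->
    a i ^+ 3 * a j = c.
  by have [s sP] := choice ex; exists s => A a c fA Aa a0 i; apply: (sP i A).
have Qi0 := col_unit_neq0 _ _ _ i Qu.
have [fi0|fi0] := eqVneq (eval_form f (col i Q)) 0; last first.
  (* Here the constant coefficient is nonzero, so [i] itself serves as [s i]. *)
  exists i => A a c fA Aa a0; rewrite -exprSr.
  rewrite (line_poly_eigen f A (col i Q) (col i Q) (a i) (a i) c 0) //.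
    by rewrite expr0 mulr1.
  by rewrite line_poly0.
have [l fl] := ns _ Qi0 fi0.
have [j pj] : exists j, (line_poly f (col i Q) (col j Q))`_1 != 0.
  apply/existsP; apply: contraR fl => /existsPn pj; apply/eqP.
  (* If every linear coefficient vanished, the gradient row [g] would satisfy [g *m Q = 0], hence be
     zero. *)
  pose g : 'rV[k]_4 := \row_l eval_form f^`M(l) (col i Q).
  suff g0 : g = 0 by have /rowP/(_ l) := g0; rewrite !mxE.
  apply: (can_inj (mulmxK Qu)); rewrite mul0mx; apply/rowP => j.
  rewrite !mxE -[RHS](eqP (negPn (pj j))) line_poly1.
  by apply: eq_bigr => h _; rewrite !mxE mulrC.
exists j => A a c fA Aa a0.
rewrite (line_poly_eigen f A (col i Q) (col j Q) (a i) (a j) c 1) //.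
rewrite expr1 [a i ^+ 4]exprSr -mulrA; congr (_ * _).
by rewrite mulrCA divff // mulr1.
Qed.
End Lines.

(** * Commuting lifts and their common eigenbasis *)

(** Dividing [A] by an [n]-th root of [s] makes it a root of ['X^n - 1], which is separable because
    [n] is nonzero in [k]. *)
Lemma diagonalizable_scalar_power (k : closedFieldType) (m n : nat)
    (A : 'M[k]_m.+1) (s : k) :
  n%:R != 0 :> k -> s != 0 -> A ^+ n = s%:M -> diagonalizable A.
Proof.
move=> n0 s0 An.
have ngt0 : (0 < n)%N by case: n n0 {An} => //; rewrite eqxx.
have /closed_rootP[t] : size ('X^n - s%:P) != 1%N.
  by rewrite size_XnsubC // eqSS -lt0n.
rewrite /root !hornerE subr_eq0 => /eqP tn.
have t0 : t != 0.
  by apply: contraNneq s0 => t0; rewrite -tn t0 expr0n eqn0Ngt ngt0.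
have [rs rsE] := closed_field_poly_normal ('X^n - 1 : {poly k}).
rewrite (monicP (monicXnsubC 1 ngt0)) scale1r in rsE.
have rsU : uniq rs by rewrite -separable_prod_XsubC -rsE separable_Xn_sub_1.
have [P Pu PA] : diagonalizable (t^-1 *: A).
  apply/diagonalizableP; exists rs => //; apply: mxminpoly_min.
  rewrite -rsE rmorphB rmorph1 rmorphXn /= horner_mx_X exprZn An -tn.
  by rewrite scale_scalar_mx exprVn mulVf ?expf_neq0 // subrr.
exists P => //; move: PA => /diagonalizable_forPex[D /(simmxP Pu) PA].
apply/diagonalizable_forPex; exists (t *: D); apply/(simmxP Pu).
have := congr1 (fun M => t *: M) PA.
by rewrite -scalemxAr scalerA mulfV // scale1r scalemxAl -linearZ.
Qed.

Lemma scalar_unit_neq0 (k : fieldType) (m n : nat) (B : 'M[k]_m.+1) (s : k) :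
  B \in unitmx -> B ^+ n = s%:M -> s != 0.
Proof.
move=> Bu Bn; have : B ^+ n \is a GRing.unit by rewrite unitrX.
rewrite Bn; apply: contraTneq => ->.
change (~~ ((0%:M : 'M[k]_m.+1) \in unitmx)).
by rewrite unitmxE det_scalar expr0n unitr0.
Qed.

(** Moving [A] past the nonzero scalar [B ^+ n] gives [c ^+ n = 1]; determinants give
    [c ^+ 4 = 1]. *)
Lemma quasicommute_comm (k : fieldType) (A B : 'M[k]_4) (c s : k) (n : nat) :
  coprime 4 n -> (0 < n)%N -> A \in unitmx -> B \in unitmx ->
  B ^+ n = s%:M -> A *m B = c *: (B *m A) -> A *m B = B *m A.
Proof.
move=> co n0 Au Bu Bn AB.
suff c1 : c = 1 by rewrite AB c1 scale1r.
have ABi i : A *m B ^+ i = c ^+ i *: (B ^+ i *m A).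
  elim: i => [|i IH]; first by rewrite !expr0 mulmx1 mul1mx scale1r.
  rewrite !exprS mulmxA AB -scalemxAl -!mulmxA IH -scalemxAr scalerA.
  by rewrite !mulmxA.
have s0 := scalar_unit_neq0 _ _ _ _ _ Bu Bn.
have cn : c ^+ n = 1.
  have /eqP := ABi n; rewrite Bn scalar_mxC !mul_scalar_mx scalerA.
  rewrite -subr_eq0 -scalerBl scaler_eq0 orbC => /orP[/eqP A0|].
    by rewrite A0 unitmxE det0 unitr0 in Au.
  by rewrite subr_eq0 -[X in X == _]mul1r (inj_eq (mulIf s0)) => /eqP.
have c4 : c ^+ 4 = 1.
  have := congr1 determinant AB; rewrite detZ !det_mulmx [\det B * _]mulrC.
  rewrite -[LHS]mul1r => /mulIf-> //.
  by rewrite mulf_neq0 // -unitfE -unitmxE.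
exact: (expr_coprime_eq1 _ _ 4 n).
Qed.

Section ProjectiveRepresentation.
Variables (k : closedFieldType) (gT : finGroupType) (P : {group gT}).
Variable rho : gT -> 'M[k]_4.
Hypothesis char0 : [pchar k] =i pred0.
Hypothesis cP : abelian P.
Hypothesis oddP : odd #|P|.
Hypothesis rho_unit : {in P, forall x, rho x \in unitmx}.
Hypothesis rhoM : {in P &, forall x y,
  exists2 c : k, c != 0 & rho (x * y)%g = c *: (rho x *m rho y)}.

Lemma rho_exp x i : x \in P ->
  exists2 c : k, c != 0 & rho (x ^+ i)%g = c *: rho x ^+ i.
Proof.
move=> Px; elim: i => [|i [c c0 IH]].
  (* The matrix [rho 1] may differ from the identity, but it is proportional to its own square,
     hence scalar. *)
  rewrite expg0 expr0; have [d d0] := rhoM 1%g 1%g (group1 P) (group1 P).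
  rewrite mulg1 scalemxAl => e; exists d^-1; rewrite ?invr_eq0 //.
  have u1 := rho_unit _ (group1 P).
  rewrite -[LHS]scale1r -(mulVf d0) -scalerA; congr (_ *: _).
  by apply: (can_inj (mulmxK u1)); rewrite mul1mx -e.
have [d d0] := rhoM x (x ^+ i)%g Px (groupX _ Px).
rewrite expgS => ->; exists (d * c); first by rewrite mulf_neq0.
by rewrite IH -scalemxAr scalerA exprS.
Qed.

Lemma rho_card x : x \in P ->
  exists2 s : k, s != 0 & rho x ^+ #|P| = s%:M.
Proof.
move=> Px; have [c c0] := rho_exp x #|P| Px; rewrite expg_cardG //.
have [d d0 ->] := rho_exp x 0 Px; rewrite expr0 => e.
exists (c^-1 * d); first by rewrite mulf_neq0 ?invr_eq0.
apply: (can_inj (scalerK c0)).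
by rewrite -e -scale_scalar_mx scalerA mulfV // scale1r -scalemx1.
Qed.

Lemma rho_commute : {in P &, forall x y, rho x *m rho y = rho y *m rho x}.
Proof.
move=> x y Px Py; have [s _ ys] := rho_card y Py.
have [c c0 e1] := rhoM x y Px Py; have [d d0 e2] := rhoM y x Py Px.
apply: (quasicommute_comm k _ _ (c^-1 * d) s #|P|); rewrite ?cardG_gt0 ?rho_unit //.
  by rewrite -[4%N]/(2 ^ 2)%N coprimeXl // coprime2n.
apply: (can_inj (scalerK c0)).
rewrite scalerA mulrA mulfV // mul1r -e1 -e2.
by rewrite (centsP cP x Px y Py).
Qed.

(** The commuting diagonalizable matrices [rho x] are codiagonalizable. The common value [s]
    reflects that [rho x ^+ #|P|] is scalar; it later allows one rescaling for all four
    eigenvalues. *)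
Lemma rho_eigenbasis :
  exists2 Q : 'M[k]_4, Q \in unitmx & exists a : gT -> 'I_4 -> k,
    {in P, forall x, [/\ forall i, rho x *m col i Q = a x i *: col i Q,
      forall i, a x i != 0 &
      exists2 s, s != 0 & forall i, a x i ^+ #|P| = s]}.
Proof.
have n0 : #|P|%:R != 0 :> k by rewrite ((GRing.pcharf0P k).1 char0) -lt0n cardG_gt0.
have [|V Vu /allP Vd] := (@codiagonalizableP _ _ [seq rho x | x in P]).1.
  split=> [_ _ /fintype.imageP[x Px ->] /fintype.imageP[y Py ->]|
      _ /fintype.imageP[x Px ->]].
    exact: rho_commute.
  by have [s s0 xs] := rho_card x Px; exact: (diagonalizable_scalar_power _ _ #|P| _ s).
(* The rows of [V] are left eigenvectors, so the columns of its inverse are the eigenvectors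
   wanted. *)
exists (invmx V); first by rewrite unitmx_inv.
exists (fun x i => (V *m rho x *m invmx V) i i) => x Px.
have /Vd/diagonalizable_forPex[D /(simmxP Vu) VD] : rho x \in [seq rho x | x in P].
  by exact: fintype.image_f.
have aE i : (V *m rho x *m invmx V) i i = D 0 i.
  by rewrite VD mulmxK // mxE eqxx.
have ev i : rho x *m col i (invmx V) = D 0 i *: col i (invmx V).
  rewrite [in LHS]colE mulmxA -colE -[rho x *m _](mulKmx Vu) (mulmxA V) VD mulmxK //.
  by rewrite mul_mx_diag; apply/colP => l; rewrite !mxE mulrC.
have evX i n : rho x ^+ n *m col i (invmx V) = D 0 i ^+ n *: col i (invmx V).
  elim: n => [|n IH]; first by rewrite !expr0 mul1mx scale1r.
  by rewrite exprS -mulmxA IH -scalemxAr ev scalerA exprSr.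
have [s s0 xs] := rho_card x Px.
have as_ i : D 0 i ^+ #|P| = s.
  have /eqP := evX i #|P|; rewrite xs mul_scalar_mx -subr_eq0 -scalerBl.
  rewrite scaler_eq0 (negPf (col_unit_neq0 _ _ _ i _)) ?unitmx_inv // orbF.
  by rewrite subr_eq0 => /eqP.
split=> [i|i|]; rewrite ?aE //; last by exists s => // i; rewrite aE.
by apply: contraNneq s0 => D0; rewrite -(as_ i) D0 expr0n eqn0Ngt cardG_gt0.
Qed.

End ProjectiveRepresentation.

(** * The substitution action, and [Paut f] as an abstract finite group *)

Lemma comp_mpolyA (R : comNzRingType) (l m n : nat) (p : {mpoly R[l]})
    (q : l.-tuple {mpoly R[m]}) (r : m.-tuple {mpoly R[n]}) :
  (p \mPo q) \mPo r = p \mPo [tuple tnth q i \mPo r | i < l].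
Proof.
rewrite [p \mPo q]comp_mpolyE raddf_sum [RHS]comp_mpolyE.
apply: eq_bigr => i _; rewrite /= comp_mpolyZ rmorph_prod; congr (_ *: _).
by apply: eq_bigr => j _; rewrite rmorphXn tnth_mktuple.
Qed.

Lemma form_actM (k : fieldType) (f : {mpoly k[4]}) (A B : 'M[k]_4) :
  form_act f (A *m B) = form_act (form_act f A) B.
Proof.
rewrite /form_act comp_mpolyA; congr (_ \mPo _); apply: eq_from_tnth => i.
rewrite !tnth_mktuple raddf_sum.
under [RHS]eq_bigr => j _.
  rewrite /= comp_mpolyZ comp_mpolyXU -tnth_nth tnth_mktuple scaler_sumr.
  under eq_bigr do rewrite scalerA.
  over.
rewrite exchange_big; apply: eq_bigr => j _.
by rewrite mxE scaler_suml.
Qed.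

Lemma form_act1 (k : fieldType) (f : {mpoly k[4]}) : form_act f 1%:M = f.
Proof.
rewrite -[RHS]comp_mpoly_id; congr (_ \mPo _); apply: eq_from_tnth => i.
rewrite !tnth_mktuple (bigD1 i) //= mxE eqxx scale1r big1 ?addr0 // => j ji.
by rewrite mxE eq_sym (negPf ji) scale0r.
Qed.

(** One matrix is chosen in each class, which replaces the quotient by matrices up to scalars. *)
Lemma Paut_representatives (k : fieldType) (f : {mpoly k[4]}) (n : nat) :
  Paut f #= `I_n.+1 ->
  exists r : 'I_n.+1 -> 'M[k]_4,
    [/\ forall i, r i \in unitmx,
      forall i, exists2 c, c != 0 & form_act f (r i) = c *: f,
      forall i j (c : k), c != 0 -> r i = c *: r j -> i = j &
      forall A, A \in unitmx -> (exists2 c, c != 0 & form_act f A = c *: f) ->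
        exists i, exists2 c, c != 0 & A = c *: r i].
Proof.
move=> /card_set_bijP[g [gfun ginj gsurj]].
have ex (i : 'I_n.+1) : exists A : GL4 k,
    (exists2 c, c != 0 & form_act f (val A) = c *: f) /\ g (PGL4_class A) = i.
  by have [_ [A fA <-] gq] := gsurj i (ltn_ord i); exists A.
have [r rP] := choice ex.
exists (fun i => val (r i)); split=> [i|i|i j c c0 rij|A Au fA].
- exact: valP.
- by have [] := rP i.
- apply: ord_inj; rewrite -(rP i).2 -(rP j).2; congr g.
  by apply/esym/PGL4_classP; exists c.
pose A' : GL4 k := exist _ A Au.
have PA : Paut f (PGL4_class A') by exists A'.
exists (Ordinal (gfun _ PA)); set i := Ordinal _.
suff /PGL4_classP : PGL4_class (r i) = PGL4_class A' by [].
apply: ginj; rewrite ?inE //; last by rewrite (rP i).2.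
by exists (r i); have [] := rP i.
Qed.

(** The product of classes is carried to the indices and realized by Cayley's embedding into
    permutations, so that Sylow theory applies. As a choice of lifts, [rho] is multiplicative only
    up to scalars. *)
Lemma Paut_group (k : fieldType) (f : {mpoly k[4]}) (n : nat) :
  Paut f #= `I_n.+1 ->
  exists (gT : finGroupType) (G : {group gT}) (rho : gT -> 'M[k]_4),
    [/\ #|G| = n.+1,
      {in G, forall x, rho x \in unitmx},
      {in G, forall x, exists2 c, c != 0 & form_act f (rho x) = c *: f},
      {in G &, forall x y (c : k), c != 0 -> rho x = c *: rho y -> x = y} &
      {in G &, forall x y,
        exists2 c : k, c != 0 & rho (x * y)%g = c *: (rho x *m rho y)}].
Proof.
move=> /Paut_representatives[r [ru rf r_inj r_surj]].
have exM i j : exists l, exists2 c, c != 0 & r i *m r j = c *: r l.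
  apply: r_surj; first by rewrite unitmx_mul !ru.
  have [c c0 fi] := rf i; have [d d0 fj] := rf j; exists (c * d).
    by rewrite mulf_neq0.
  by rewrite form_actM fi /form_act comp_mpolyZ -/(form_act f (r j)) fj scalerA.
have [m mP] := choice (fun ij : 'I_n.+1 * 'I_n.+1 => exM ij.1 ij.2).
pose mul i j := m (i, j).
have mulP i j : exists2 c, c != 0 & r i *m r j = c *: r (mul i j) by exact: mP (i, j).
have [|e [u u0 re]] := r_surj 1%:M (unitmx1 _ _).
  by exists 1; rewrite ?oner_neq0 // form_act1 scale1r.
have r_eq i j (c d : k) : c != 0 -> d != 0 -> c *: r i = d *: r j -> i = j.
  move=> c0 d0 cd; apply: (r_inj i j (c^-1 * d)).
    by rewrite mulf_neq0 ?invr_eq0.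
  by rewrite -scalerA -cd scalerA mulVf // scale1r.
have mule i : mul i e = i.
  have [c c0] := mulP i e; rewrite -[r e](scalerK u0) -re -scalemxAr mulmx1.
  by move/esym/r_eq; apply=> //; rewrite invr_eq0.
have emul i : mul e i = i.
  have [c c0] := mulP e i; rewrite -[r e](scalerK u0) -re -scalemxAl mul1mx.
  by move/esym/r_eq; apply=> //; rewrite invr_eq0.
have mulA i j l : mul (mul i j) l = mul i (mul j l).
  have [c c0 e1] := mulP i j; have [d d0 e2] := mulP (mul i j) l.
  have [c' c0' e3] := mulP j l; have [d' d0' e4] := mulP i (mul j l).
  apply: (r_eq _ _ (c * d) (c' * d')); rewrite ?mulf_neq0 //.
  rewrite -!scalerA -e2 -e4 scalemxAl -e1 scalemxAr -e3.
  by rewrite mulmxA.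
have mul_inj j : injective (mul^~ j).
  move=> i l il; have [c c0 e1] := mulP i j; have [d d0] := mulP l j.
  rewrite -il -[r (mul i j)](scalerK c0) -e1 scalerA scalemxAl.
  move=> /(can_inj (mulmxK (ru j))) e2.
  apply: (r_inj i l (c / d)); first by rewrite mulf_neq0 ?invr_eq0.
  by rewrite e2 scalerA mulrA divfK // mulfV // scale1r.
(* Right translations, as the product of permutations reads left to right. *)
pose R j := perm (@mul_inj j).
have RM i j : (R i * R j)%g = R (mul i j).
  by apply/permP => l; rewrite permM !permE mulA.
have RE j : R j e = j by rewrite permE emul.
have R1 : R e = 1%g by apply/permP => i; rewrite perm1 permE mule.
pose G := [set R j | j : 'I_n.+1]%SET.
have gG : group_set G.
  apply/group_setP; split=> [|_ _ /imsetP[i _ ->] /imsetP[j _ ->]].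
    by rewrite -R1 imset_f.
  by rewrite RM imset_f.
(* A translation is recovered from its value at the neutral index [e]. *)
exists {perm 'I_n.+1}, (Group gG), (fun x : {perm 'I_n.+1} => r (x e)); split=> /=.
- by rewrite card_imset ?card_ord // => i j ij; rewrite -(RE i) ij RE.
- by move=> x _; exact: ru.
- by move=> x _; exact: rf.
- move=> _ _ /imsetP[i _ ->] /imsetP[j _ ->] c c0.
  by rewrite !RE => /r_inj->.
- move=> _ _ /imsetP[i _ ->] /imsetP[j _ ->]; rewrite RM !RE.
  have [c c0 e1] := mulP i j; exists c^-1; first by rewrite invr_eq0.
  by rewrite e1 scalerK.
Qed.

(** * Normalized weights and the final count *)

(** The scalar must satisfy [u ^+ 49 = d^-1] and [u ^+ 4 = c^-1]. As 4 and 49 are coprime, the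
    compatibility [c ^+ 49 = d ^+ 4] makes this solvable. *)
Lemma weight_normalization (k : fieldType) (s : 'I_4 -> 'I_4) (a : 'I_4 -> k)
    (c d : k) :
  d != 0 -> (forall i, a i ^+ 49 = d) -> (forall i, a i ^+ 3 * a (s i) = c) ->
  exists2 u : k, u != 0 & forall i,
    (u * a i) ^+ 49 = 1 /\ (u * a i) ^+ 3 * (u * a (s i)) = 1.
Proof.
move=> d0 ad ac.
have cd : c ^+ 49 = d ^+ 4.
  by rewrite -(ac ord0) exprMn exprAC !ad -exprSr.
have c0 : c != 0.
  have : c ^+ 49 != 0 by rewrite cd expf_neq0.
  by rewrite expf_eq0.
(* [4 * 37 = 3 * 49 + 1] and [c ^ 49 = d ^ 4]. *)
exists (d ^+ 3 / c ^+ 37) => [|i]; first by rewrite mulf_neq0 ?invr_eq0 ?expf_neq0.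
split.
  rewrite exprMn ad expr_div_n [c ^+ _ ^+ _]exprAC cd -!exprM mulrAC -exprSr.
  by rewrite divff // expf_neq0.
rewrite exprMn mulrACA -exprSr ac expr_div_n -mulrA -!exprM.
have -> : (d ^+ (3 * 4)) = c ^+ (49 * 3) by rewrite [RHS]exprM cd -exprM.
by rewrite mulrCA -exprSr mulVf // expf_neq0.
Qed.

Theorem proposition4p3 (k : closedFieldType) (char0 : [pchar k] =i pred0)
    (f : {mpoly k[4]}) (hf : f \is 4.-homog) (nsf : nonsingular f)
    (n : nat) (card_G : Paut f #= `I_n) :
  (logn 7 n <= 1)%N.
Proof.
case: n card_G => [_|n /Paut_group[gT [G [rho [oG rho_unit rho_f rho_inj rhoM]]]]].
  by rewrite logn0.
rewrite leqNgt; apply/negP => lt1.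
have [S sylS] := Sylow_exists 7 G.
have /and3P[sSG pS _] := sylS.
have [|Q [sQS _ oQ]] := @normal_pgroup 7 gT 2 S S pS (normal_refl S).
  by rewrite (card_Hall sylS) oG logn_part.
have sQG : {subset Q <= G}
  by apply/fintype.subsetP; exact: fintype.subset_trans sQS sSG.
have cQ : abelian Q.
  by apply: (p2group_abelian (pgroupS sQS pS)); rewrite oQ pfactorK.
have Qunit : {in Q, forall x, rho x \in unitmx} by move=> x /sQG; apply: rho_unit.
have QM : {in Q &, forall x y,
    exists2 c : k, c != 0 & rho (x * y)%g = c *: (rho x *m rho y)}.
  by move=> x y /sQG Gx /sQG; apply: rhoM.
have oddQ : odd #|Q| by rewrite oQ.
have [V Vu [a aP]] := rho_eigenbasis k gT Q rho char0 cQ oddQ Qunit QM.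
have [s sP] := nonsingular_eigen_monomial k f V char0 hf nsf Vu.
(* Membership in [Q] stays under the existential so that [choice] yields a total function, with
   default 0 outside [Q]. *)
have exu x : exists u : k, x \in Q -> u != 0 /\ forall i,
    (u * a x i) ^+ 49 = 1 /\ (u * a x i) ^+ 3 * (u * a x (s i)) = 1.
  have [Qx|] := boolP (x \in Q); last by exists 0.
  have [ev a0 [d d0 ad]] := aP x Qx; rewrite oQ in ad.
  have [c _ fx] := rho_f x (sQG x Qx).
  have [u u0 uP] := weight_normalization _ s (a x) c d d0 ad (sP _ _ _ fx ev a0).
  by exists u.
have [u uP] := choice exu.
pose b x i := u x * a x i.
have b3 x i : x \in Q -> b x i ^+ 3 * b x (s i) = 1.
  by move=> /uP[_ /(_ i)[]].
have b7 x i : x \in Q -> b x i ^+ 7 = 1.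
  move=> Qx; apply: (weight_seventh_root _ s (b x) i) => j; last exact: b3.
  by have [_ /(_ j)[]] := uP x Qx.
have [p p_inj] := weight_determined k s.
have bp_inj : {in Q &, injective (b^~ p)}.
  move=> x y Qx Qy bxy.
  have bE i : b x i = b y i.
    by apply: p_inj bxy i => i; rewrite ?b7 ?b3.
  have [ux _] := uP x Qx; have [uy _] := uP y Qy.
  (* Equal normalized weights make the two lifts proportional on the eigenbasis, with ratio
     [u y / u x]. *)
  apply: (rho_inj x y (sQG x Qx) (sQG y Qy) ((u x)^-1 * u y)).
    by rewrite mulf_neq0 ?invr_eq0.
  apply: (can_inj (mulmxK Vu)); apply/matrixP => j i.
  have colE A : (A *m V) j i = (A *m col i V) j 0.
    by rewrite !mxE; apply: eq_bigr => l _; rewrite mxE.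
  have [evx _ _] := aP x Qx; have [evy _ _] := aP y Qy.
  rewrite !colE -scalemxAl evx evy !mxE !mulrA; congr (_ * _).
  by rewrite -mulrA -/(b y i) -bE mulKf.
(* The 49 elements of [Q] would give 49 distinct 7th roots of unity. *)
have := @max_unity_roots k 7 [seq b x p | x <- enum Q] isT.
rewrite size_map -cardE oQ map_inj_in_uniq ?enum_uniq; last first.
  by move=> x y; rewrite !mem_enum; apply: bp_inj.
rewrite all_map (_ : all _ _) //.
  by move=> /(_ isT isT).
by apply/allP => x; rewrite mem_enum => Qx; apply/unity_rootP/b7.
Qed.
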